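(* Let $\Gamma$ be a finite subset of $\mathbf{Z}$, with $\gamma_{+}=\max\Gamma\geq 0$ and $\gamma_{-}=\min\Gamma\leq 0$, and let $n\in\mathbf{N}$. Then $\mathcal{C}_{n}^{\Gamma}$, the set of $\Gamma$-paths of length $n$, is a (finite) distributive lattice with respect to coordinatewise meet and join if and only if $$(\Delta^{\Gamma}+\Gamma)\cap[\gamma_{-},\gamma_{+}]\subseteq\Gamma.$$
   Context: $\mathbf{N}$ is the set of nonnegative integers and $\mathbf{Z}$ the set of all integers; for $x,y\in\mathbf{Z}$, $[x,y]$ denotes the interval of integers between $x$ and $y$. For $n\in\mathbf{N}$, the set of $\Gamma$-paths of length $n$ is $$\mathcal{C}_{n}^{\Gamma}=\{f:[0,n]\to\mathbf{N}\mid f(0)=f(n)=0,\ f(k+1)-f(k)\in\Gamma\ \text{for all } k<n\}.$$ It is ordered by $f\le g$ whenever $f(i)\le g(i)$ for every $i\le n$. The coordinatewise join and meet of $f$ and $g$ are given by $(f\lor g)(i)=f(i)\lor g(i)$ and $(f\land g)(i)=f(i)\land g(i)$, where the join and meet on the right-hand sides are computed in $\mathbf{N}$ (that is, they are the maximum and the minimum of $f(i)$ and $g(i)$). For $h\in\mathbf{N}$, $$\Delta_{h}^{\Gamma}=\Big\{\sum_{i=1}^{h}(x_{i}-y_{i})\ \Big|\ x_{i},y_{i}\in\Gamma,\ x_{i}\neq y_{j}\ \text{for all } i,j\Big\},$$ and $\Delta^{\Gamma}=\bigcup_{h\in\mathbf{N}}\Delta_{h}^{\Gamma}$. Finally, $\Delta^{\Gamma}+\Gamma=\{\delta+\gamma\mid\delta\in\Delta^{\Gamma},\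 \gamma\in\Gamma\}$.
   Formalization: ''If'' is proved for every n; the equivalence is with ''C_n is a distributive lattice for all n'' (false for n = 0, Γ = {-1,0,2}) and assumes max Γ = 0 iff min Γ = 0 (false for Γ = {0,1,3}, where each C_n is one path). An empty C_n counts as a lattice. *)

(* Defs.v *)
From HB Require Import structures.
From mathcomp Require Import all_boot all_order all_algebra finmap.

Set Implicit Arguments.
Unset Strict Implicit.
Unset Printing Implicit Defensive.

Import Order.TTheory GRing.Theory Num.Theory.
Local Open Scope ring_scope.

Definition is_max (G : {fset int}) (m : int) : Prop :=
  m \in G /\ forall x, x \in G -> x <= m.

Definition is_min (G : {fset int}) (m : int) : Prop :=
  m \in G /\ forall x, x \in G -> m <= x.

(* [widen_ord (leqnSn n) k] and [lift ord0 k] are k and k + 1 in [0, n]. *)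
Definition gpath (G : {fset int}) (n : nat) : pred {ffun 'I_n.+1 -> nat} :=
  fun f => [&& f ord0 == 0%N, f ord_max == 0%N
    & [forall k : 'I_n,
        (f (lift ord0 k))%:Z - (f (widen_ord (leqnSn n) k))%:Z \in G]].

Definition fle (n : nat) (f g : {ffun 'I_n.+1 -> nat}) : bool :=
  [forall i, (f i <= g i)%N].

Definition fmeet (n : nat) (f g : {ffun 'I_n.+1 -> nat}) :
  {ffun 'I_n.+1 -> nat} := [ffun i => minn (f i) (g i)].

Definition fjoin (n : nat) (f g : {ffun 'I_n.+1 -> nat}) :
  {ffun 'I_n.+1 -> nat} := [ffun i => maxn (f i) (g i)].

(* C is a finite distributive lattice for the coordinatewise order, meet and
   join: it is the image of a finDistrLatticeType under an injection carrying
   the lattice order, meet and join to the coordinatewise ones.  As C need not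
   be nonempty (there may be no path of a given length), no top or bottom is
   required. *)
Definition coordinatewise_finDistrLattice (n : nat)
    (C : pred {ffun 'I_n.+1 -> nat}) : Prop :=
  exists (d : Order.disp_t) (L : finDistrLatticeType d)
         (e : L -> {ffun 'I_n.+1 -> nat}),
    [/\ injective e,
        forall f, C f <-> exists x, f = e x,
        forall x y, (x <= y)%O = fle (e x) (e y),
        forall x y, e (Order.meet x y) = fmeet (e x) (e y)
      & forall x y, e (Order.join x y) = fjoin (e x) (e y)].

Definition Delta_ (G : {fset int}) (h : nat) (z : int) : Prop :=
  exists x y : 'I_h -> int,
    [/\ forall i, x i \in G,
        forall i, y i \in G,
        forall i j, x i <> y j
      & z = \sum_(i < h) (x i - y i)].

Definition Delta (G : {fset int}) (z : int) : Prop := exists h, Delta_ G h z.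

Definition Delta_plus (G : {fset int}) (z : int) : Prop :=
  exists d g : int, [/\ Delta G d, g \in G & z = d + g].

(* Main.v *)
(* Coordinatewise meets and joins obey all lattice identities, so the paths form
   a distributive lattice iff they are closed under both.  The meet or join of
   two paths can acquire a new step only where they cross, and that step is a
   step of one path plus the difference of heights, an element of [Delta]; it
   lies between the two crossing steps, hence between [gmin] and [gmax].
   Conversely, given [z = d + g] with [d] in [Delta], let two paths rise to a
   difference of heights [d], then let the upper one (if [d >= 0]) take the step
   [g] and the lower one [gmax]: as [z <= gmax], the meet takes the step [z].
   If [d < 0], let the lower one take [g] and the upper one [gmin], and look at
   the join. *)
From HB Require Import structures.
Require Import Defs.
From mathcomp Require Import all_boot all_order all_algebra finmap zify.

Set Implicit Arguments.
Unset Strict Implicit.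
Unset Printing Implicit Defensive.

Import Order.TTheory GRing.Theory Num.Theory.
Local Open Scope ring_scope.

(** * Lattices from bounded families closed under meet and join *)

Section Lattice.
Variables (n : nat) (C : pred {ffun 'I_n.+1 -> nat}).

Lemma lattice_closed : coordinatewise_finDistrLattice C ->
  forall f g, C f -> C g -> C (fmeet f g) /\ C (fjoin f g).
Proof.
move=> [d [L [e [_ Ce _ eI eU]]]] f g /Ce [x ->] /Ce [y ->].
by rewrite -eI -eU; split; apply/Ce; [exists (Order.meet x y) | exists (Order.join x y)].
Qed.

Variable b : nat.
Hypothesis C_bounded : forall f, C f -> forall i, (f i <= b)%N.
Hypothesis C_closed : forall f g, C f -> C g -> C (fmeet f g) /\ C (fjoin f g).

(** Functions into [nat] do not form a finite type, so the members of [C] are found by filtering the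
    finitely many functions into ['I_b.+1]; as [b] bounds [C], none is lost. *)
Definition bounded_enum : seq {ffun 'I_n.+1 -> nat} :=
  [seq f <- [seq [ffun i => val (g i)] | g : {ffun 'I_n.+1 -> 'I_b.+1}] | C f].

Lemma mem_bounded_enum f : (f \in bounded_enum) = C f.
Proof.
rewrite mem_filter andb_idr // => Cf; apply/imageP.
exists [ffun i => inord (f i)] => //.
by apply/ffunP => i; rewrite !ffunE /= inordK // ltnS C_bounded.
Qed.

Definition closed_family := seq_sub bounded_enum.
HB.instance Definition _ := SubFinite.on closed_family.

Lemma val_in (x : closed_family) : C (val x).
Proof. by rewrite -mem_bounded_enum; apply: ssvalP. Qed.

Lemma meet_in (x y : closed_family) : fmeet (val x) (val y) \in bounded_enum.
Proof. by rewrite mem_bounded_enum; case: (C_closed (val_in x) (val_in y)). Qed.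
Lemma join_in (x y : closed_family) : fjoin (val x) (val y) \in bounded_enum.
Proof. by rewrite mem_bounded_enum; case: (C_closed (val_in x) (val_in y)). Qed.

Definition lmeet (x y : closed_family) : closed_family := SeqSub (meet_in x y).
Definition ljoin (x y : closed_family) : closed_family := SeqSub (join_in x y).
Definition lle (x y : closed_family) : bool := fle (val x) (val y).
Definition llt (x y : closed_family) : bool := (y != x) && lle x y.

Lemma lle_def x y : lle x y = (lmeet x y == x).
Proof.
apply/forallP/eqP => [le_xy|<- i]; last by rewrite ffunE; lia.
by apply/val_inj/ffunP => i; rewrite ffunE; apply/minn_idPl.
Qed.

Fact lmeetC : commutative lmeet.
Proof. by move=> x y; apply/val_inj/ffunP => i; rewrite !ffunE minnC. Qed.
Fact ljoinC : commutative ljoin.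
Proof. by move=> x y; apply/val_inj/ffunP => i; rewrite !ffunE maxnC. Qed.
Fact lmeetA : associative lmeet.
Proof. by move=> x y z; apply/val_inj/ffunP => i; rewrite !ffunE minnA. Qed.
Fact ljoinA : associative ljoin.
Proof. by move=> x y z; apply/val_inj/ffunP => i; rewrite !ffunE maxnA. Qed.
Fact ljoinKI y x : lmeet x (ljoin x y) = x.
Proof. by apply/val_inj/ffunP => i; rewrite !ffunE /= ?ffunE; lia. Qed.
Fact lmeetKU y x : ljoin x (lmeet x y) = x.
Proof. by apply/val_inj/ffunP => i; rewrite !ffunE /= ?ffunE; lia. Qed.
Fact lmeetUl : left_distributive lmeet ljoin.
Proof. by move=> x y z; apply/val_inj/ffunP => i; rewrite !ffunE minn_maxl. Qed.
Fact lmeetxx : idempotent_op lmeet.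
Proof. by move=> x; apply/val_inj/ffunP => i; rewrite !ffunE minnn. Qed.

HB.instance Definition _ := Order.isMeetJoinDistrLattice.Build
  (Order.Disp tt tt) closed_family lle_def (fun _ _ => erefl)
  lmeetC ljoinC lmeetA ljoinA ljoinKI lmeetKU lmeetUl lmeetxx.

Lemma closed_lattice : coordinatewise_finDistrLattice C.
Proof.
exists (Order.Disp tt tt), (closed_family : finDistrLatticeType _), val.
split=> //; first exact: val_inj.
move=> f; split=> [Cf|[x ->]]; last exact: val_in.
by rewrite -mem_bounded_enum in Cf; exists (SeqSub Cf).
Qed.

End Lattice.

(** * Heights and steps of paths *)

Lemma gpathP (G : {fset int}) n (f : {ffun 'I_n.+1 -> nat}) :
  reflect [/\ f (inord 0) = 0%N, f (inord n) = 0%N &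
    forall k, (k < n)%N -> (f (inord k.+1))%:Z - (f (inord k))%:Z \in G]
    (gpath G f).
Proof.
have -> : inord 0 = ord0 :> 'I_n.+1 by apply/val_inj; rewrite /= inordK.
have -> : inord n = ord_max :> 'I_n.+1 by apply/val_inj; rewrite /= inordK.
have liftE (k : 'I_n) : lift ord0 k = inord k.+1.
  by apply/val_inj; rewrite /= inordK // ltnS.
have widenE (k : 'I_n) : widen_ord (leqnSn n) k = inord k.
  by apply/val_inj; rewrite /= inordK // ltnS ltnW.
apply: (iffP and3P) => [[/eqP f0 /eqP fn /forallP fG]|[f0 fn fG]].
  split=> // k lt_kn; have := fG (Ordinal lt_kn).
  by rewrite liftE widenE.
split; [exact/eqP | exact/eqP | apply/forallP => k].
by rewrite liftE widenE fG.
Qed.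

(** Each step climbs at most [m]. This uniform bound is what makes the set of paths finite. *)
Lemma gpath_bounded (G : {fset int}) (m : nat) n (f : {ffun 'I_n.+1 -> nat}) :
  (forall x, x \in G -> x <= m%:Z) -> gpath G f ->
  forall i, (f i <= n * m)%N.
Proof.
move=> Gm /gpathP [f0 _ fG] i; rewrite -(inord_val i).
suff fle k : (k <= n)%N -> (f (inord k) <= k * m)%N.
  have le_in : (i <= n)%N by rewrite -ltnS.
  by apply: leq_trans (fle i le_in) _; rewrite leq_mul2r le_in orbT.
elim: k => [|k IHk] lt_kn; first by rewrite f0.
by have := Gm _ (fG k lt_kn); have := IHk (ltnW lt_kn); lia.
Qed.

Definition gsteps n (f : {ffun 'I_n.+1 -> nat}) (k : nat) : seq int :=
  [seq (f (inord i.+1))%:Z - (f (inord i))%:Z | i <- iota 0 k].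

Lemma gsteps_in (G : {fset int}) n (f : {ffun 'I_n.+1 -> nat}) k :
  gpath G f -> (k <= n)%N -> {subset gsteps f k <= G}.
Proof.
move=> /gpathP [_ _ fG] le_kn x /mapP [i]; rewrite mem_iota => lt_ik ->.
by apply: fG; lia.
Qed.

Lemma sum_gsteps (G : {fset int}) n (f : {ffun 'I_n.+1 -> nat}) k :
  gpath G f -> \sum_(a <- gsteps f k) a = (f (inord k))%:Z.
Proof.
move=> /gpathP [f0 _ _]; rewrite big_map.
have := telescope_sumr (fun i => (f (inord i))%:Z) (leq0n k).
by rewrite /index_iota subn0 f0 subr0.
Qed.

(** [Delta] wants no letter common to both sides. A common letter is removed once from each word,
    which keeps the lengths equal and the difference of the sums unchanged, until the words are
    disjoint. *)
Lemma Delta_sub_sum (G : {fset int}) (x y : seq int) :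
  size x = size y -> {subset x <= G} -> {subset y <= G} ->
  Delta G (\sum_(a <- x) a - \sum_(a <- y) a).
Proof.
have [k] := ubnP (size x); elim: k x y => // k IHk x y lt_xk eq_xy xG yG.
have [/hasP [a ay ax]|/hasPn dis] := boolP (has (mem x) y).
  rewrite (big_rem a ax) (big_rem a ay) /= opprD addrACA subrr add0r.
  have x_gt0 : (0 < size x)%N by case: (x) ax.
  apply: IHk.
  - by rewrite size_rem // -ltnS prednK.
  - by rewrite !size_rem // eq_xy.
  - by move=> b /mem_rem/xG.
  - by move=> b /mem_rem/yG.
exists (size x), (fun i => nth 0 x i), (fun i => nth 0 y i); split.
- by move=> i; apply/xG/mem_nth.
- by move=> i; apply/yG/mem_nth; rewrite -eq_xy.
- move=> i j eq_ij; have /dis : nth 0 y j \in y by rewrite mem_nth // -eq_xy.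
  by rewrite -eq_ij /= mem_nth.
have sumE (s : seq int) : \sum_(a <- s) a = \sum_(i < size s) s`_i.
  by rewrite (big_nth 0) big_mkord.
by rewrite (sumE x) (sumE y) -eq_xy -sumrB.
Qed.

Lemma gpath_delta (G : {fset int}) n (f g : {ffun 'I_n.+1 -> nat}) k :
  gpath G f -> gpath G g -> (k <= n)%N ->
  Delta G ((f (inord k))%:Z - (g (inord k))%:Z).
Proof.
move=> Cf Cg le_kn; rewrite -(sum_gsteps k Cf) -(sum_gsteps k Cg).
by apply: Delta_sub_sum; [rewrite !size_map | exact: gsteps_in..].
Qed.

(** * Sufficiency: steps at a crossing *)

Section Sufficiency.
Variables (G : {fset int}) (gmax gmin : int).
Hypotheses (Hmax : is_max G gmax) (Hmin : is_min G gmin).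
Hypothesis HG : forall z, Delta_plus G z -> gmin <= z <= gmax -> z \in G.

Lemma crossing_step n (f g : {ffun 'I_n.+1 -> nat}) k :
  gpath G f -> gpath G g -> (k < n)%N ->
  (f (inord k) < g (inord k))%N -> (g (inord k.+1) < f (inord k.+1))%N ->
  (g (inord k.+1))%:Z - (f (inord k))%:Z \in G /\
  (f (inord k.+1))%:Z - (g (inord k))%:Z \in G.
Proof.
move=> Cf Cg lt_kn lt_fg lt_gf.
have [[_ _ /(_ _ lt_kn) fG] [_ _ /(_ _ lt_kn) gG]] := (gpathP _ _ Cf, gpathP _ _ Cg).
have [[_ /(_ _ fG) fmax] [_ /(_ _ gG) gmin']] := (Hmax, Hmin).
(* Since [f] starts below [g] and ends above it, both mixed differences lie strictly between the
   step of [g] and the step of [f]. *)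
split; apply: HG; try (apply/andP; split; lia).
- exists ((g (inord k))%:Z - (f (inord k))%:Z), ((g (inord k.+1))%:Z - (g (inord k))%:Z).
  by split=> //; [exact: gpath_delta (ltnW _) | lia].
- exists ((f (inord k))%:Z - (g (inord k))%:Z), ((f (inord k.+1))%:Z - (f (inord k))%:Z).
  by split=> //; [exact: gpath_delta (ltnW _) | lia].
Qed.

Lemma gpath_closed n (f g : {ffun 'I_n.+1 -> nat}) :
  gpath G f -> gpath G g -> gpath G (fmeet f g) /\ gpath G (fjoin f g).
Proof.
move=> Cf Cg.
have [[f0 fn fG] [g0 gn gG]] := (gpathP _ _ Cf, gpathP _ _ Cg).
split; apply/gpathP; split; rewrite ?ffunE ?f0 ?fn ?g0 ?gn // => k lt_kn;
  have := fG k lt_kn; have := gG k lt_kn;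
  have := crossing_step Cf Cg lt_kn; have := crossing_step Cg Cf lt_kn;
  rewrite !ffunE;
  (* Without a strict crossing, both ends of the new step can be read off the same path; only the
     two crossing cases use [crossing_step]. *)
  case: (ltngtP (f (inord k)) (g (inord k))) => [lt1|lt1|->];
  case: (ltngtP (f (inord k.+1)) (g (inord k.+1))) => [lt2|lt2|eq2] //;
  rewrite ?eq2 //; try (by move=> _ /(_ isT isT) []);
  try (by move=> /(_ isT isT) []).
Qed.

End Sufficiency.

(** * Necessity: paths reading prescribed words *)

Lemma sum_nseq (c : int) k : \sum_(a <- nseq k c) a = c * k%:Z.
Proof. by rewrite big_nseq iter_addr_0 -mulr_natr natz. Qed.

Lemma sum_lower (q : nat) (s : seq int) :
  (forall a, a \in s -> - q%:Z <= a) -> - (q * size s)%:Z <= \sum_(a <- s) a.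
Proof.
elim: s => [|b s IHs] sq; first by rewrite big_nil /= muln0.
rewrite big_cons /=; have := sq b (mem_head _ _).
have : - (q * size s)%:Z <= \sum_(a <- s) a.
  by apply: IHs => a sa; apply: sq; rewrite inE sa orbT.
by rewrite mulnS; move: (\sum_(a <- s) a) => S; lia.
Qed.

(** The absolute value only serves to land in [nat]; it changes nothing when the partial sums are
    nonnegative. *)
Definition word_path n (w : seq int) : {ffun 'I_n.+1 -> nat} :=
  [ffun i : 'I_n.+1 => `|(\sum_(a <- take i w) a)%R|%N].

Lemma word_pathE n w k :
  (forall j, 0 <= \sum_(a <- take j w) a) -> (k <= n)%N ->
  (word_path n w (inord k))%:Z = \sum_(a <- take k w) a.
Proof. by move=> w_ge0 le_kn; rewrite ffunE inordK // gez0_abs. Qed.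

Lemma word_path_gpath (G : {fset int}) (w : seq int) :
  {subset w <= G} -> (forall k, 0 <= \sum_(a <- take k w) a) ->
  \sum_(a <- w) a = 0 -> gpath G (word_path (size w) w).
Proof.
move=> wG w_ge0 w_sum; apply/gpathP; split.
- by rewrite ffunE inordK // take0 big_nil.
- by rewrite ffunE inordK // take_size w_sum.
move=> k lt_kw; rewrite !word_pathE // 1?ltnW //.
rewrite (take_nth 0 lt_kw) -cats1 big_cat big_seq1 /= addrAC subrr add0r.
exact/wG/mem_nth.
Qed.

(** The initial climb to [N * p] exceeds or equals any possible descent along [m]; the final descent
    starts at [K * q] and reaches exactly 0 after its [K] steps. *)
Lemma mountain_ge0 (p q N K : nat) (m : seq int) :
  (forall a, a \in m -> - q%:Z <= a) -> (q * size m <= N * p)%N ->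
  (N * p)%:Z + \sum_(a <- m) a = (K * q)%:Z ->
  forall k, 0 <= \sum_(a <- take k (nseq N p%:Z ++ m ++ nseq K (- q%:Z))) a.
Proof.
move=> mq le_mN sumE k; rewrite take_cat size_nseq.
case: ltnP => [lt_kN|le_Nk]; first by rewrite take_nseq 1?ltnW // sum_nseq; lia.
rewrite big_cat sum_nseq take_cat /=.
case: ltnP => [lt_km|le_mk].
  set t := take _ m; have : - (q * size t)%:Z <= \sum_(a <- t) a.
    by apply: sum_lower => a /mem_take/mq.
  have : (q * size t <= q * size m)%N.
    by rewrite leq_mul2l size_take; case: ltnP; rewrite ?orbT //; lia.
  move: (\sum_(a <- t) a) => T; by lia.
rewrite big_cat /=; move: (\sum_(a <- m) a) sumE => S sumE; set j := (k - N - size m)%N.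
have [le_jK|lt_Kj] := leqP j K.
  rewrite take_nseq // sum_nseq.
  have : (j * q <= K * q)%N by rewrite leq_mul2r le_jK orbT.
  by lia.
by rewrite take_oversize ?size_nseq 1?ltnW // sum_nseq; lia.
Qed.

Lemma sum_flatten_nseq (w : seq int) k :
  \sum_(a <- flatten (nseq k w)) a = k%:Z * \sum_(a <- w) a.
Proof.
elim: k => [|k IHk] /=; first by rewrite big_nil mul0r.
by rewrite big_cat /= IHk; move: (\sum_(a <- w) a) => S; lia.
Qed.

(* After the initial climb, one path reads [w1 w2 (w1 w2)^(q-1)] and the other
   [w2 w1 (w1 w2)^(q-1)]: both gain the same multiple of [q], so the same
   number of steps [-q] brings both back to [0]. *)
Lemma gpath_embed_words (G : {fset int}) (p q : nat) (w1 w2 : seq int) :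
  (0 < p)%N -> (0 < q)%N -> p%:Z \in G -> - q%:Z \in G ->
  (forall a, a \in G -> - q%:Z <= a) ->
  {subset w1 <= G} -> {subset w2 <= G} -> size w1 = size w2 ->
  exists n k c (f g : {ffun 'I_n.+1 -> nat}),
    [/\ gpath G f, gpath G g, (k + size w1 <= n)%N &
      forall j, (j <= size w1)%N ->
        (f (inord (k + j)))%:Z = c + \sum_(a <- take j w1) a /\
        (g (inord (k + j)))%:Z = c + \sum_(a <- take j w2) a].
Proof.
move=> p_gt0 q_gt0 pG qG Gq w1G w2G eq_w.
(* With the leading pair of words this makes [q] pairs, so the middle part sums to [q * S]. *)
pose rest := flatten (nseq q.-1 (w1 ++ w2)).
(* [M] steps descend by at most [q * M], which is at most [N * p]. *)
pose M := size (w1 ++ w2 ++ rest); pose N := (q * M)%N.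
pose S := \sum_(a <- w1) a + \sum_(a <- w2) a.
(* After the middle part the height is [N * p + q * S = q * (M * p + S)], whence the number of steps
   [-q]; [low] shows that this number is nonnegative. *)
pose K := `|((M * p)%:Z + S)%R|%N.
pose W u v := nseq N p%:Z ++ (u ++ v ++ rest) ++ nseq K (- q%:Z).
have restG : {subset rest <= G}.
  move=> a /flattenP [w /nseqP [-> _]]; rewrite mem_cat => /orP [].
    exact: w1G.
  exact: w2G.
have main u v : {subset u <= G} -> {subset v <= G} ->
    size (u ++ v ++ rest) = M -> \sum_(a <- u) a + \sum_(a <- v) a = S ->
  [/\ size (W u v) = (N + M + K)%N, gpath G (word_path (size (W u v)) (W u v)),
      forall k, 0 <= \sum_(a <- take k (W u v)) a &
      forall j, (j <= size u)%N ->
        \sum_(a <- take (N + j) (W u v)) a = (N * p)%:Z + \sum_(a <- take j u) a].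
  move=> uG vG sM sS.
  have mG : {subset u ++ v ++ rest <= G}.
    by move=> a; rewrite !mem_cat => /or3P [/uG|/vG|/restG].
  have mq a : a \in u ++ v ++ rest -> - q%:Z <= a by move=> /mG/Gq.
  have sumE : \sum_(a <- u ++ v ++ rest) a = q%:Z * S.
    rewrite !big_cat sum_flatten_nseq big_cat /= addrA sS -/S.
    by rewrite -[q in RHS]prednK //; move: (S) (q.-1) => S' r; lia.
  (* The middle sum [q * S] is at least [- q * M], hence [S >= - M >= - M * p]. *)
  have low : 0 <= (M * p)%:Z + S.
    have := sum_lower mq; rewrite sumE sM => low.
    have : 0 <= q%:Z * (M%:Z + S) by move: (S) low => S'; lia.
    rewrite pmulr_rge0 // => low'.
    have : (M * 1 <= M * p)%N by rewrite leq_mul2l p_gt0 orbT.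
    by move: (S) low' => S'; lia.
  have KE : K%:Z = (M * p)%:Z + S by rewrite gez0_abs.
  have topE : (N * p)%:Z + \sum_(a <- u ++ v ++ rest) a = (K * q)%:Z.
    by rewrite sumE (PoszM K) KE /N; move: (S) => S'; lia.
  have W_ge0 k : 0 <= \sum_(a <- take k (W u v)) a.
    apply: mountain_ge0 => //; rewrite sM /N.
    by rewrite leq_pmulr.
  have WG : {subset W u v <= G}.
    move=> a; rewrite mem_cat => /orP [/nseqP [-> //]|].
    by rewrite mem_cat => /orP [/mG //|/nseqP [-> //]].
  split=> //.
  - by rewrite size_cat (size_cat (u ++ v ++ rest)) !size_nseq sM addnA.
  - apply: word_path_gpath => //.
    rewrite big_cat /= big_cat /= addrA !sum_nseq.
    by move: (\sum_(a <- u ++ v ++ rest) a) topE => T; lia.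
  move=> j le_ju; rewrite take_cat size_nseq ltnNge leq_addr /= addKn.
  by rewrite -!catA takel_cat // big_cat sum_nseq /= PoszM mulrC.
have [] := main w1 w2 w1G w2G erefl erefl; set Wf := W w1 w2 => sf Cf f0 fE.
have [] : _ := main w2 w1 w2G w1G _ (addrC _ _).
  by rewrite /M !size_cat addnCA.
set Wg := W w2 w1 => sg Cg g0 gE.
move: Cf Cg; rewrite sf sg => Cf Cg.
exists (N + M + K)%N, N, (N * p)%:Z.
exists (word_path (N + M + K) Wf), (word_path (N + M + K) Wg).
have le_wM : (size w1 <= M)%N by rewrite /M size_cat leq_addr.
split=> //; first by lia.
move=> j le_jw; have le_n : (N + j <= N + M + K)%N by lia.
by rewrite !word_pathE // fE // gE // -eq_w.
Qed.

Lemma Delta_seq (G : {fset int}) d : Delta G d ->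
  exists x y : seq int, [/\ size x = size y, {subset x <= G}, {subset y <= G} &
    d = \sum_(a <- x) a - \sum_(a <- y) a].
Proof.
move=> [h [x [y [xG yG _ ->]]]].
exists [seq x i | i <- index_enum 'I_h], [seq y i | i <- index_enum 'I_h]; split.
- by rewrite !size_map.
- by move=> _ /mapP [i _ ->].
- by move=> _ /mapP [i _ ->].
by rewrite !big_map sumrB.
Qed.

Lemma closed_Delta_plus (G : {fset int}) (p q : nat) :
  (0 < p)%N -> (0 < q)%N -> is_max G p%:Z -> is_min G (- q%:Z) ->
  (forall n (f g : {ffun 'I_n.+1 -> nat}), gpath G f -> gpath G g ->
     gpath G (fmeet f g) /\ gpath G (fjoin f g)) ->
  forall z, Delta_plus G z -> - q%:Z <= z <= p%:Z -> z \in G.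
Proof.
move=> p_gt0 q_gt0 [pG _] [qG Gq] clG z [d [g0 [Dd gG zE]]] /andP [le_qz le_zp].
have [x [y [eq_xy xG yG dE]]] := Delta_seq Dd.
(* [f] will read [x] then [g0], and [g] will read [y] then [s]. The extreme step [s] keeps the end
   of [g] on the far side of that of [f], or level with it. *)
pose s : int := if 0 <= d then p%:Z else - q%:Z.
have sG : s \in G by rewrite /s; case: ifP.
have rconsG (w : seq int) a : {subset w <= G} -> a \in G -> {subset rcons w a <= G}.
  by move=> wG aG b; rewrite mem_rcons inE => /predU1P [->|/wG].
have [|n [k [c [f [g [Cf Cg le_kn fgE]]]]]] :=
  gpath_embed_words p_gt0 q_gt0 pG qG Gq (rconsG x g0 xG gG) (rconsG y s yG sG).
  by rewrite !size_rcons eq_xy.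
move: le_kn fgE; rewrite size_rcons => le_kn fgE.
have takeS m (w : seq int) a : m = size w -> take m (rcons w a) = w.
  by move=> ->; rewrite -cats1 take_size_cat.
have takeSS m (w : seq int) a : m = size w -> take m.+1 (rcons w a) = rcons w a.
  by move=> ->; rewrite -(size_rcons w a) take_size.
have := fgE (size x) (leqnSn _); have := fgE (size x).+1 (leqnn _).
rewrite !takeSS // !takeS //.
rewrite -!cats1 !big_cat !big_seq1 /= addnS.
set i := (k + size x)%N.
move: (\sum_(a <- x) a) (\sum_(a <- y) a) dE => X Y dE [f2 g2] [f1 g1].
have lt_in : (i < n)%N by rewrite /i -addnS.
have [] := clG n f g Cf Cg.
move=> /gpathP [_ _ /(_ i lt_in)]; rewrite !ffunE => meetG.
move=> /gpathP [_ _ /(_ i lt_in)]; rewrite !ffunE => joinG.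
move: f1 g1 f2 g2 meetG joinG.
move: (f (inord i)) (g (inord i)) (f (inord i.+1)) (g (inord i.+1)) => a b a' b'.
move=> f1 g1 f2 g2; rewrite /s in f2 g2; case: ifP g2 => d_ge0 g2 meetG joinG.
  (* Here [a - b = d >= 0], so the meet starts at [b]; as [a' - b = z <= p = b' - b], it ends at
     [a']. *)
  have -> : z = (minn a' b')%:Z - (minn a b)%:Z by lia.
  exact: meetG.
have -> : z = (maxn a' b')%:Z - (maxn a b)%:Z by lia.
exact: joinG.
Qed.

Theorem theorem2p1 (G : {fset int}) (gmax gmin : int)
    (Hmax : is_max G gmax) (Hmin : is_min G gmin)
    (Hmax_ge0 : 0 <= gmax) (Hmin_le0 : gmin <= 0) :
  (* sufficiency of the condition, for every G and every n *)
  (forall n : nat,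
     (forall z : int, Delta_plus G z -> gmin <= z <= gmax -> z \in G) ->
     coordinatewise_finDistrLattice (@gpath G n))
  /\
  (* the equivalence; it fails when exactly one of gmax, gmin is 0 *)
  ((gmax = 0 <-> gmin = 0) ->
     ((forall n : nat, coordinatewise_finDistrLattice (@gpath G n)) <->
      (forall z : int, Delta_plus G z -> gmin <= z <= gmax -> z \in G))).
Proof.
have suff_cond n :
    (forall z : int, Delta_plus G z -> gmin <= z <= gmax -> z \in G) ->
    coordinatewise_finDistrLattice (@gpath G n).
  move=> HG; apply: (@closed_lattice _ _ (n * `|gmax|)).
    move=> f; apply: gpath_bounded => x xG.
    by rewrite gez0_abs //; case: Hmax => _; apply.
  by move=> f g; apply: (gpath_closed Hmax Hmin HG).
split=> // eq0; split=> [lattG|HG n]; last exact: suff_cond.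
have clG n (f g : {ffun 'I_n.+1 -> nat}) := lattice_closed (lattG n) (f := f) (g := g).
(* If [gmax = 0], then [gmin = 0] too and the interval contains only 0, which is in [G] as its
   maximum. *)
have [p0|p_neq0] := eqVneq gmax 0.
  move=> z _; have /eq0 -> := p0; rewrite p0 => z0.
  have -> : z = 0 by lia.
  by rewrite -p0; case: Hmax.
have q_neq0 : gmin <> 0 by move=> /eq0 p0; rewrite p0 eqxx in p_neq0.
have pE : gmax = `|gmax|%N%:Z by lia.
have qE : gmin = - `|gmin|%N%:Z by lia.
rewrite pE qE; apply: closed_Delta_plus => //; first by lia.
- by lia.
- by rewrite -pE.
- by rewrite -qE.
Qed.
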